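(* Let $s(n)=\sum_{k\ge 0}\operatorname{bit}_k(n+k)2^k$ for $n\ge 0$, let $t(1)<t(2)<t(3)<\cdots$ be the nonnegative integers not of the form $s(n)$ ($n\ge 0$), listed in increasing order, and let $d(n)=\sum_{k=0}^{n}\operatorname{bit}_k(n-k)2^k$ for $n\ge0$. Then: (i) For $n\ge 0$, $$ t(n+1)=2^n-\tfrac12+\tfrac12\sum_{k=0}^{n}(-1)^{\lfloor (n-k)/2^k\rfloor}\,2^k. $$ (ii) $t(1)=1$, $t(2)=2$, and for all integers $i\ge 1$ and $i\le j\le 2^i+i$, $$ t(2^i+j)=\begin{cases} 2^{2^i+i}-2^i+t(i) & \text{if } j=i,\\ 2^{2^i+j}-2^i-2^j+t(j) & \text{if } i<j\le 2^i+i.\end{cases} $$ (iii) For $n\ge 1$, $$ t(n)=-n+\sum_{k\ge 1,\; n-k\equiv 0\pmod{2^k}} 2^k. $$ (iv) For $n\ge 1$, $t(n)=2^n-1-d(n-1)$. (v) If $s$ is extended to all integers $n$ by $s(n)=n+\sum_{k\ge 1,\; n+k\equiv 0 \pmod{2^k}}2^k$ (a finite sum for every integer $n$), then $t(n)=s(-n)$ for all $n\ge 1$.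
   Context: For integers $m\ge 0$ and $k\ge 0$, $\operatorname{bit}_k(m)=\lfloor m/2^k\rfloor \bmod 2$ is the coefficient of $2^k$ in the binary expansion of $m$. The sequence $s$ (sloping binary numbers, obtained by reading right-justified binary expansions of $0,1,2,\dots$ along upward-sloping diagonals) begins $0,3,6,5,4,15,10,\dots$; the missing values $t(n)$ begin $1,2,7,12,29,62,\dots$. For $n\ge 0$ one has $s(n)=n+\sum_{k\ge1,\,n+k\equiv0\pmod{2^k}}2^k$, so the extension in (v) agrees with $s$ on $n\ge 0$. *)

(* Defs.v *)
From mathcomp Require Import all_boot all_order all_algebra.
From mathcomp Require Import boolp classical_sets functions cardinality fsbigop.

Set Implicit Arguments.
Unset Strict Implicit.
Unset Printing Implicit Defensive.

Import Order.TTheory GRing.Theory Num.Theory.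
Local Open Scope classical_set_scope.
Local Open Scope ring_scope.

Definition bit (k m : nat) : nat := ((m %/ 2 ^ k) %% 2)%N.

(* The sum runs over all k; its terms vanish for k > n because n + k < 2 ^ k. *)
Definition sloping (n : nat) : nat :=
  (\big[addn/0]_(k \in [set: nat]) (bit k (n + k) * 2 ^ k))%N.

(* The value of t at 0 is irrelevant: the listing is indexed from 1. *)
Definition lists_missing (t : nat -> nat) : Prop :=
  (forall i j : nat, (1 <= i)%N -> (i < j)%N -> (t i < t j)%N) /\
  t @` [set n | (1 <= n)%N] = ~` range sloping.

Definition down_sloping (n : nat) : nat :=
  (\sum_(0 <= k < n.+1) bit k (n - k) * 2 ^ k)%N.

Definition carry_set (n : int) : set nat :=
  [set k | (1 <= k)%N /\ (n + k%:Z = 0 %[mod 2 ^+ k])%Z].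

(* A sum over an infinite support would be 0 by convention; the support here is
   finite for every n, since 2 ^ k > |n + k| > 0 for all large k. *)
Definition sloping_ext (n : int) : int :=
  n + \sum_(k \in carry_set n) (2 : int) ^+ k.

(* Main.v *)
(* Read at an arbitrary integer m, in two's complement, the sum of
   bit_k(m + k) 2 ^ k is a bijection from the integers onto the naturals.  Its
   first K bits determine m modulo 2 ^ K, and on the window -K <= m < 2 ^ K - K
   the bits of index at least K vanish; hence it maps that window injectively,
   and so bijectively, to the naturals below 2 ^ K.  The values missed by s are
   therefore those at -n, n >= 1, and the value at -n lies in
   [2 ^ (n - 1), 2 ^ n), so they come in increasing order. *)
Require Import Defs.
From mathcomp Require Import all_boot all_order all_algebra.
From mathcomp Require Import boolp classical_sets functions cardinality fsbigop.
From mathcomp Require Import zify ring.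

Set Implicit Arguments.
Unset Strict Implicit.
Unset Printing Implicit Defensive.

Import Order.TTheory GRing.Theory Num.Theory.
Local Open Scope classical_set_scope.
Local Open Scope ring_scope.

Definition bitz (k : nat) (x : int) : int := ((x %/ 2 ^+ k)%Z %% 2)%Z.

(** The sum defining [sloping], cut off after [K] digits but read at any integer; [divz] rounds down
    here, so negative arguments get two's complement digits. *)
Definition slope (K : nat) (m : int) : int :=
  \sum_(0 <= k < K) bitz k (m + k%:Z) * 2 ^+ k.

Lemma exp2zE (k : nat) : 2 ^+ k = (2 ^ k)%N%:Z :> int.
Proof. by rewrite -natz natrX natz. Qed.

Lemma exp2z_gt0 (k : nat) : 0 < 2 ^+ k :> int.
Proof. exact: exprn_gt0. Qed.

Lemma exp2z_neq0 (k : nat) : 2 ^+ k != 0 :> int.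
Proof. by rewrite expf_neq0. Qed.
#[local] Hint Resolve exp2z_gt0 exp2z_neq0 : core.

Lemma ltz_exp2 (k : nat) : k%:Z < 2 ^+ k.
Proof. by rewrite exp2zE; exact: (ltn_expl k (isT : 1 < 2)%N). Qed.

Lemma modz_exp2_ge0 (k : nat) (x : int) : 0 <= (x %% 2 ^+ k)%Z.
Proof. exact: modz_ge0. Qed.

Lemma modz_exp2_lt (k : nat) (x : int) : (x %% 2 ^+ k)%Z < 2 ^+ k.
Proof. exact: ltz_pmod. Qed.
#[local] Hint Resolve modz_exp2_ge0 modz_exp2_lt : core.

Lemma bitz_nat (k a : nat) : bitz k a%:Z = (bit k a)%:Z.
Proof. by rewrite /bitz exp2zE divz_nat modz_nat. Qed.

(** In two's complement, passing from [a] to [- a - 1] flips every digit. *)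
Lemma bitz_oppS (k a : nat) : bitz k (- a.+1%:Z) = 1 - (bit k a)%:Z.
Proof.
rewrite /bitz exp2zE -NegzE divNz_nat ?expn_gt0//.
by rewrite -NegzE modNz_nat// /bit; lia.
Qed.

Lemma bitz_bound (k : nat) (x : int) : 0 <= bitz k x <= 1.
Proof.
have h1 : 0 <= bitz k x by apply: modz_ge0.
have : bitz k x < 2 by apply: ltz_pmod.
lia.
Qed.

Lemma modz_exp2S (k : nat) (x : int) :
  (x %% 2 ^+ k.+1)%Z = (x %% 2 ^+ k)%Z + bitz k x * 2 ^+ k.
Proof.
have hb := bitz_bound k x.
have ge0 := modz_exp2_ge0 k x; have lt := modz_exp2_lt k x.
rewrite {1}(divz_eq x (2 ^+ k)) {1}(divz_eq (x %/ 2 ^+ k)%Z 2).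
rewrite mulrDl -mulrA -exprS -addrA modzMDl addrC -/(bitz k x) modz_small//.
rewrite exprS; case/andP: hb; move: (bitz k x) (2 ^+ k) (x %% 2 ^+ k)%Z ge0 lt.
move=> b d r; nia.
Qed.

Lemma modz_pred (d x : int) : 0 < d ->
  ((x - 1) %% d)%Z = (x %% d)%Z - 1 + (if (d %| x)%Z then d else 0).
Proof.
move=> d0; have ge0 : 0 <= (x %% d)%Z by apply: modz_ge0; rewrite gt_eqF.
have lt : (x %% d)%Z < d by exact: ltz_pmod.
rewrite {1}(divz_eq x d) -addrA modzMDl.
case: ifPn => [/dvdz_mod0P ->|/dvdz_mod0P nd].
  by rewrite -(modzMDl 1) modz_small; lia.
by rewrite addr0 modz_small; lia.
Qed.

(* Writing each term as a difference of residues of m + k, the sum telescopes up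
   to a unit step, which wraps around exactly when 2 ^ k divides m + k. *)
Lemma slope_carry (K : nat) (m : int) :
  slope K m = ((m + K%:Z) %% 2 ^+ K)%Z - K%:Z
    + \sum_(1 <= k < K.+1 | (2 ^+ k %| m + k%:Z)%Z) 2 ^+ k.
Proof.
elim: K => [|K IH].
  by rewrite /slope !big_geq//= expr0 modz1.
rewrite /slope big_nat_recr//= -/(slope K m) IH big_mkcond [in RHS]big_mkcond.
rewrite [in RHS]big_nat_recr//= -big_mkcond /=.
have := modz_exp2S K (m + K%:Z).
have -> : m + K%:Z = m + K.+1%:Z - 1 by lia.
rewrite modz_pred//.
move: (bitz _ _ * _) (_ %% 2 ^+ K.+1)%Z (_ %% 2 ^+ K)%Z => a b c.
by case: ifP; lia.
Qed.

(** * Injectivity and surjectivity of the digit sums *)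

Lemma slope_ge0 (K : nat) (m : int) : 0 <= slope K m.
Proof.
apply: sumr_ge0 => k _; rewrite mulr_ge0 ?exprn_ge0//.
by case/andP: (bitz_bound k (m + k%:Z)).
Qed.

Lemma slope_lt (K : nat) (m : int) : slope K m < 2 ^+ K.
Proof.
elim: K => [|K IH]; first by rewrite /slope big_geq.
rewrite /slope big_nat_recr//= -/(slope K m) exprS.
case/andP: (bitz_bound K (m + K%:Z)).
move: (bitz _ _) (slope _ _) (2 ^+ K) IH (exp2z_gt0 K) => b s d; nia.
Qed.

(** As [slope K] lies in [[0, 2 ^ K)], it and the digit of index [K] are the remainder and the
    quotient of [slope K.+1] by [2 ^ K]. *)
Lemma slopeS_inj (K : nat) (m m' : int) : slope K.+1 m = slope K.+1 m' ->
  slope K m = slope K m' /\ bitz K (m + K%:Z) = bitz K (m' + K%:Z).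
Proof.
rewrite /slope !big_nat_recr//= -!/(slope _ _).
move: (slope_ge0 K m) (slope_lt K m) (slope_ge0 K m') (slope_lt K m').
move: (slope K m) (slope K m') (bitz _ _) (bitz _ _) (2 ^+ K) => s s' b b' d.
move=> *; have bb : b = b' by nia.
by split=> //; subst b'; lia.
Qed.

(** By induction the lower digits fix [m + K] modulo [2 ^ K]; its bit of index [K] then lifts this
    to modulo [2 ^ K.+1]. *)
Lemma slope_inj_mod (K : nat) (m m' : int) : slope K m = slope K m' ->
  (m = m' %[mod 2 ^+ K])%Z.
Proof.
elim: K => [|K IH]; first by rewrite expr0 !modz1.
case/slopeS_inj => /IH/eqP; rewrite -(eqz_modDr K%:Z) => /eqP e eb.
by apply/eqP; rewrite -(eqz_modDr K%:Z) !modz_exp2S e eb.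
Qed.

Lemma window_lt (K k : nat) (m : int) : (K <= k)%N -> 0 <= m + K%:Z < 2 ^+ K ->
  0 <= m + k%:Z < 2 ^+ k.
Proof.
elim: k => [|k IH]; first by rewrite leqn0 => /eqP ->.
rewrite leq_eqVlt => /predU1P[->//|/IH {}IH /IH].
by rewrite exprS; have := ltz_exp2 k; lia.
Qed.

Lemma slope_stable (K L : nat) (m : int) : (K <= L)%N ->
  0 <= m + K%:Z < 2 ^+ K -> slope L m = slope K m.
Proof.
move=> KL hm; rewrite /slope (big_cat_nat (leq0n K) KL)//=.
rewrite [X in _ + X]big_nat [X in _ + X]big1 ?addr0//.
move=> k /andP[Kk _]; have := window_lt Kk hm => hk.
by rewrite /bitz divz_small ?mod0z ?mul0r// gtz0_abs.
Qed.

Lemma slope_eq_inj (K : nat) (m m' : int) :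
  (forall L, (K <= L)%N -> slope L m = slope L m') -> m = m'.
Proof.
(* This choice gives [2 ^ L > L > |m - m'|], while [2 ^ L] divides [m - m']. *)
move=> h; pose L := maxn K (absz (m - m')).+1.
have /slope_inj_mod/eqP : slope L m = slope L m' by apply: h; rewrite leq_maxl.
rewrite eqz_mod_dvd => /dvdzP[q].
have : `|m - m'| < 2 ^+ L.
  by apply: lt_trans (ltz_exp2 L); rewrite /L; lia.
move: (2 ^+ L) => d; case: (q =P 0) => [->|]; first by lia.
move=> q0 hd e; exfalso; move: hd; rewrite e normrM.
have : `|q| >= 1 by lia.
nia.
Qed.

(** The window has [2 ^ K] elements [i - K], pairwise distinct modulo [2 ^ K], so an injection into
    the [2 ^ K] possible values is onto. *)
Lemma slope_surj (K N : nat) : (N < 2 ^ K)%N ->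
  exists2 m : int, 0 <= m + K%:Z < 2 ^+ K & slope K m = N%:Z.
Proof.
move=> hN; have e2 := exp2zE K.
have fP (i : 'I_(2 ^ K)) : (absz (slope K (i%:Z - K%:Z)) < 2 ^ K)%N.
  have := slope_lt K (i%:Z - K%:Z); rewrite e2.
  by have := slope_ge0 K (i%:Z - K%:Z); lia.
have f_inj : injective (fun i => Ordinal (fP i)).
  move=> i j /(congr1 val)/= e; apply: val_inj => /=.
  have : slope K (i%:Z - K%:Z) = slope K (j%:Z - K%:Z).
    have := slope_ge0 K (i%:Z - K%:Z).
    by have := slope_ge0 K (j%:Z - K%:Z); lia.
  move/slope_inj_mod/eqP; rewrite eqz_modDr e2 !modz_nat !modn_small ?ltn_ord//.
  by move/eqP => [].
have := injF_onto f_inj (Ordinal hN) => /codomP[i /(congr1 val)/= e].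
exists (i%:Z - K%:Z); first by rewrite subrK e2; have := ltn_ord i; lia.
by have := slope_ge0 K (i%:Z - K%:Z); lia.
Qed.

(** * Comparison with the sums over infinite index sets *)

Lemma window_exists (m : int) : exists K : nat, 0 <= m + K%:Z < 2 ^+ K.
Proof. by exists (absz m).+1; rewrite exprS; have := ltz_exp2 (absz m); lia. Qed.

Lemma sloping_slope (K n : nat) : n%:Z + K%:Z < 2 ^+ K ->
  (sloping n)%:Z = slope K n%:Z.
Proof.
move=> hK; have big k : (K <= k)%N -> (n + k < 2 ^ k)%N.
  move=> Kk; have : 0 <= n%:Z + k%:Z < 2 ^+ k by apply: (window_lt Kk); lia.
  by rewrite exp2zE; lia.
(* The support lies below [K]: for [k >= K] the number [n + k] is less than [2 ^ k]. *)
rewrite /sloping (@fsbigE _ _ addn _ _ (index_iota 0 K)) ?iota_uniq//=; last first.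
  move=> k _; rewrite mem_index_iota /= -leqNgt => /big lt.
  by rewrite /bit divn_small.
rewrite (eq_bigl xpredT); last by move=> k; rewrite in_setT.
rewrite -natz natr_sum /slope; apply: eq_bigr => k _.
by rewrite natrM natrX natz -PoszD bitz_nat.
Qed.

(** For [k > K], [m + k] lies strictly between 0 and [2 ^ k], hence is not divisible by it. *)
Lemma carry_window (K : nat) (m : int) : 0 <= m + K%:Z < 2 ^+ K ->
  carry_set m = [set` [seq k <- index_iota 1 K.+1 | (2 ^+ k %| m + k%:Z)%Z]].
Proof.
move=> hm; rewrite /carry_set; apply/seteqP; split=> k /=;
  rewrite mem_filter mem_index_iota mod0z.
  move=> [k1 /dvdz_mod0P dv]; rewrite dv k1/= ltnS leqNgt; apply/negP => Kk.
  have := window_lt (ltnW Kk) hm => hk; have /dvdz_mod0P := dv.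
  by rewrite modz_small//; lia.
by case/and3P => /dvdz_mod0P -> ->.
Qed.

Lemma carry_set_finite (m : int) : finite_set (carry_set m).
Proof.
by have [K /carry_window ->] := window_exists m; exact: finite_seq.
Qed.

(** In the window [m + K] is its own residue modulo [2 ^ K], so the first two terms of [slope_carry]
    reduce to [m]. *)
Lemma sloping_ext_slope (K : nat) (m : int) : 0 <= m + K%:Z < 2 ^+ K ->
  sloping_ext m = slope K m.
Proof.
move=> hm; rewrite /sloping_ext (carry_window hm) -fsbig_seq; last first.
  by rewrite filter_uniq ?iota_uniq.
by rewrite big_filter slope_carry modz_small// addrK.
Qed.

(** * The missing values *)

Definition missing (n : nat) : nat := absz (slope n (- n%:Z)).

Lemma missingE (n : nat) : (missing n)%:Z = slope n (- n%:Z).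
Proof. by rewrite gez0_abs ?slope_ge0. Qed.

(** The integer [- n] is the left end of the window of [n], which is why [missing] needs only [n]
    digits. *)
Lemma window_opp (n : nat) : 0 <= - n%:Z + n%:Z < 2 ^+ n.
Proof. by rewrite addNr lexx exp2z_gt0. Qed.

Lemma slope_oppS (n : nat) :
  slope n.+1 (- n.+1%:Z) = \sum_(0 <= k < n.+1) (1 - (bit k (n - k))%:Z) * 2 ^+ k.
Proof.
apply: eq_big_nat => k /andP[_ kn].
by rewrite (_ : - n.+1%:Z + k%:Z = - (n - k).+1%:Z) ?bitz_oppS//; lia.
Qed.

Lemma missing_lt (n : nat) : (missing n < 2 ^ n)%N.
Proof. by have := slope_lt n (- n%:Z); rewrite -missingE exp2zE. Qed.

(** The top digit, of index [n], is the complement of a digit of 0, hence 1. *)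
Lemma missing_ge (n : nat) : (2 ^ n <= missing n.+1)%N.
Proof.
have := missingE n.+1; rewrite slope_oppS big_nat_recr//= subnn.
rewrite {2}/bit div0n mod0n subr0 mul1r exp2zE.
move=> e; rewrite -lez_nat e lerDr.
apply: sumr_ge0 => i _; rewrite mulr_ge0 ?exprn_ge0//.
by rewrite subr_ge0 lez_nat -ltnS ltn_mod.
Qed.

Lemma missing_mono (i j : nat) : (i < j)%N -> (missing i < missing j)%N.
Proof.
case: j => // j ij; apply: leq_trans (missing_ge j).
by apply: leq_trans (missing_lt i) _; rewrite leq_exp2l.
Qed.

Lemma missing_range : missing @` [set n | (1 <= n)%N] = ~` range sloping.
Proof.
apply/seteqP; split=> [_ /= [n n1 <-] [m _ e]|N nN].
  have [K hK] := window_exists m%:Z.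
  have hK' : m%:Z + K%:Z < 2 ^+ K by case/andP: hK.
  (* A common value would give [m] and [- n] the same digits at every large length. *)
  suff : m%:Z = - n%:Z by move: n1; lia.
  apply: (@slope_eq_inj (maxn K n)) => L; rewrite geq_max => /andP[KL nL].
  rewrite (slope_stable KL hK) (slope_stable nL (window_opp n)).
  by rewrite -missingE -e (sloping_slope hK').
(* As [N < 2 ^ N], the value [N] is attained in the window of [N]; the sign of its argument [m]
   decides whether [sloping] or [missing] takes it. *)
have [m hm em] := slope_surj (ltn_expl N (isT : 1 < 2)%N).
have [m0|m0] := leP 0 m.
  case: nN; exists (absz m) => //; apply/eqP.
  rewrite -eqz_nat (@sloping_slope N) gez0_abs ?em//.
  by case/andP: hm.
exists (absz m) => /=; first by lia.
apply/eqP; rewrite -eqz_nat missingE lez0_abs ?opprK -?em; last exact: ltW.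
apply/eqP; have hm' : 0 <= m + (absz m)%:Z < 2 ^+ absz m.
  by have := ltz_exp2 (absz m); lia.
by rewrite -(slope_stable (leq_maxl _ N) hm') (slope_stable (leq_maxr _ N) hm).
Qed.

Lemma lists_missing_missing : lists_missing missing.
Proof. by split; [move=> i j _; exact: missing_mono | exact: missing_range]. Qed.

(** * Uniqueness of the increasing listing *)

Lemma lists_missing_le (f g : nat -> nat) (n : nat) :
  lists_missing f -> lists_missing g -> (1 <= n)%N ->
  (forall k, (1 <= k < n)%N -> f k = g k) -> (f n <= g n)%N.
Proof.
move=> [fm fr] [gm gr] n1 fg.
have : (g @` [set n | (1 <= n)%N]) (g n) by exists n.
(* Write [g n = f m]. If [m < n], then [f m = g m < g n], a contradiction; so [n <= m] and
   [f n <= f m]. *)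
rewrite gr -fr => -[m /= m1 e]; have [mn|nm] := ltnP m n.
  by have := gm _ _ m1 mn; rewrite -e fg ?m1 ?ltnn.
rewrite -e; move: nm; rewrite leq_eqVlt => /predU1P[->//|/(fm _ _ n1)].
exact: ltnW.
Qed.

Lemma lists_missing_unique (f g : nat -> nat) : lists_missing f ->
  lists_missing g -> forall n, (1 <= n)%N -> f n = g n.
Proof.
move=> hf hg; elim/ltn_ind => n IH n1.
have fg k : (1 <= k < n)%N -> f k = g k by case/andP=> k1 kn; exact: IH.
apply/eqP; rewrite eqn_leq (lists_missing_le hf hg)//.
by rewrite (lists_missing_le hg hf)// => k /fg.
Qed.

(** * Closed forms and the recurrence *)

Lemma missing_down (n : nat) :
  (missing n.+1)%:Z = 2 ^+ n.+1 - 1 - (down_sloping n)%:Z.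
Proof.
rewrite missingE slope_oppS (eq_bigr (fun k => 2 ^+ k - (bit k (n - k) * 2 ^ k)%:Z)).
  rewrite sumrB big_mkord subrX1 (_ : 2 - 1 = 1) ?mul1r//; congr (_ - _).
  by rewrite /down_sloping -natz natr_sum; apply: eq_bigr => k _; rewrite natz.
by move=> k _; rewrite mulrBl mul1r PoszM exp2zE.
Qed.

(** The sign attached to a digit [b] is [1 - 2 * b]. *)
Lemma sum_signs_down (n : nat) :
  \sum_(0 <= k < n.+1) (-1) ^+ ((n - k) %/ 2 ^ k)%N * 2 ^+ k
  = 2 ^+ n.+1 - 1 - 2 * (down_sloping n)%:R :> rat.
Proof.
rewrite (eq_bigr (fun k => 2 ^+ k - 2 * (bit k (n - k) * 2 ^ k)%:R)).
  rewrite sumrB -mulr_sumr -natr_sum; congr (_ - _).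
  by rewrite big_mkord subrX1 (_ : 2 - 1 = 1) ?mul1r.
move=> k _; rewrite -signr_odd natrM natrX /bit modn2.
by case: (odd _) => /=; ring.
Qed.

Lemma missing_signs (n : nat) :
  (missing n.+1)%:R = 2 ^+ n - 1 / 2
       + 1 / 2 * \sum_(0 <= k < n.+1) (-1) ^+ ((n - k) %/ 2 ^ k)%N * 2 ^+ k
       :> rat.
Proof.
rewrite sum_signs_down -[LHS]/((missing n.+1)%:Z%:~R) missing_down.
by rewrite !rmorphB rmorphXn/= exprS; field.
Qed.

(** The sum in (iii). Stopping at [k = n] matters: beyond it the truncated [n - k] would be 0 and
    pass the divisibility test. *)
Definition carries (n : nat) : nat :=
  (\sum_(1 <= k < n.+1 | 2 ^ k %| n - k) 2 ^ k)%N.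

Lemma missing_carries (n : nat) : (missing n)%:Z = (carries n)%:Z - n%:Z.
Proof.
rewrite missingE slope_carry addNr mod0z sub0r addrC; congr (_ - _).
rewrite -[RHS]natz natr_sum [LHS]big_nat_cond [RHS]big_nat_cond.
apply: eq_big => [k|k _]; last by rewrite natrX.
case: (boolP (0 < k < n.+1)%N) => //= /andP[_ kn].
rewrite exp2zE dvdzE /=; congr (_ %| _)%N; lia.
Qed.

(* Since n - k < 2 ^ k for i < k < n, only k = n contributes. *)
Lemma carries_top (i n : nat) : (i < n)%N -> (n <= 2 ^ i.+1 + i)%N ->
  (\sum_(i.+1 <= k < n.+1 | 2 ^ k %| n - k) 2 ^ k)%N = (2 ^ n)%N.
Proof.
move=> lt_in hn; rewrite big_mkcond big_nat_recr//= subnn dvdn0 big_nat big1 ?add0n//.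
move=> k /andP[ik kn]; rewrite gtnNdvd ?subn_gt0//.
by have : (2 ^ i.+1 <= 2 ^ k)%N by [rewrite leq_exp2l]; lia.
Qed.

(** Split both sums after [k = i]. Up to [i], [2 ^ k] divides [2 ^ i], so the shift changes nothing;
    above [i] only the top terms survive, and for [j = i] the sum for [j] has none there. *)
Lemma carries_shift (i j : nat) :
  (1 <= i)%N -> (i <= j)%N -> (j <= 2 ^ i + i)%N ->
  (carries (2 ^ i + j) + (if j == i then 0 else 2 ^ j)
   = carries j + 2 ^ (2 ^ i + j))%N.
Proof.
move=> i1 ij ji; have i0 : (0 < 2 ^ i)%N by rewrite expn_gt0.
have lt_n : (i < 2 ^ i + j)%N by lia.
rewrite /carries (big_cat_nat (n := i.+1))//=; last by lia.
rewrite (carries_top lt_n); last by rewrite expnS; lia.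
rewrite [in RHS](big_cat_nat (n := i.+1))//=.
rewrite [X in (X + _ + _)%N](_ : _ = (\sum_(1 <= k < i.+1 | 2 ^ k %| j - k) 2 ^ k)%N).
  have [->|/eqP ne] := eqVneq j i; first by rewrite (@big_geq _ _ _ i.+1)//; lia.
  by rewrite (@carries_top i j) ?expnS; lia.
rewrite [LHS]big_nat_cond [RHS]big_nat_cond; apply: eq_bigl => k.
case: (boolP (0 < k < i.+1)%N) => //= /andP[_ ki]; rewrite -addnBA; last by lia.
by rewrite dvdn_addr// dvdn_exp2l.
Qed.

(** The numbers [n - k] and [- n + k] are opposite, so they have the same divisors. *)
Lemma missing_carry_set (n : nat) :
  [set k : nat | (1 <= k)%N /\ (n%:Z - k%:Z = 0 %[mod 2 ^+ k])%Z] = carry_set (- n%:Z).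
Proof.
rewrite /carry_set; apply/seteqP; split=> k /= [k1];
  rewrite mod0z => /dvdz_mod0P dv; split=> //;
  by apply/dvdz_mod0P; rewrite dvdzE -(abszN (_ + _)) -dvdzE opprD ?opprK.
Qed.

Theorem theorem3 :
  (exists t : nat -> nat, lists_missing t) /\
  forall t : nat -> nat, lists_missing t ->
  (* (i) *)
  (forall n : nat,
     (t n.+1)%:R = 2 ^+ n - 1 / 2
       + 1 / 2 * \sum_(0 <= k < n.+1) (-1) ^+ ((n - k) %/ 2 ^ k)%N * 2 ^+ k
       :> rat) /\
  (* (ii) *)
  (t 1%N = 1%N /\ t 2%N = 2%N /\
   forall i j : nat, (1 <= i)%N -> (i <= j)%N -> (j <= 2 ^ i + i)%N ->
     (t (2 ^ i + j)%N)%:Z =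
       if j == i then 2 ^+ (2 ^ i + i)%N - 2 ^+ i + (t i)%:Z
       else 2 ^+ (2 ^ i + j)%N - 2 ^+ i - 2 ^+ j + (t j)%:Z) /\
  (* (iii) *)
  (forall n : nat, (1 <= n)%N ->
     (t n)%:Z = - n%:Z +
       \sum_(k \in [set k : nat |
                     (1 <= k)%N /\ (n%:Z - k%:Z = 0 %[mod 2 ^+ k])%Z]) (2 : int) ^+ k) /\
  (* (iv) *)
  (forall n : nat, (1 <= n)%N ->
     (t n)%:Z = 2 ^+ n - 1 - (down_sloping n.-1)%:Z) /\
  (* (v) *)
  ((forall n : int, finite_set (carry_set n)) /\
   (forall n : nat, sloping_ext n%:Z = (sloping n)%:Z) /\
   (forall n : nat, (1 <= n)%N -> (t n)%:Z = sloping_ext (- n%:Z))).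
Proof.
split; first by exists missing; exact: lists_missing_missing.
move=> t /lists_missing_unique/(_ lists_missing_missing) tE.
have ext n : (1 <= n)%N -> (t n)%:Z = sloping_ext (- n%:Z).
  by move=> n1; rewrite tE// missingE (sloping_ext_slope (window_opp n)).
split; first by move=> n; rewrite tE// missing_signs.
split.
  rewrite !tE//; split.
    apply/eqP; rewrite -eqz_nat missing_down.
    by rewrite /down_sloping !big_nat_recr//= big_geq.
  split.
    apply/eqP; rewrite -eqz_nat missing_down.
    by rewrite /down_sloping !big_nat_recr//= big_geq.
  move=> i j i1 ij ji; have := carries_shift i1 ij ji.
  (* The term [- 2 ^ i] of the recurrence comes from the linear parts [- (2 ^ i + j)] and [- j]. *)
  rewrite !tE ?missing_carries ?exp2zE; [|lia..].
  by case: eqVneq => [->|_]; lia.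
split; first by move=> n n1; rewrite ext// missing_carry_set.
split; first by case=> // n _; rewrite tE// missing_down.
split; first exact: carry_set_finite.
split=> // n; have [K hK] := window_exists n%:Z.
by rewrite (sloping_ext_slope hK) (@sloping_slope K)//; case/andP: hK.
Qed.
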